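(* For $r,m\in\mathbb{N}$, let $S(r,m)$ denote the smallest $\Sigma\bigwedge\Sigma$-size that suffices to compute every $r$-variate polynomial $f\in\mathbb{C}[t_1,\dots,t_r]$ with $\operatorname{DPD}(f)\le m$; that is, $S(r,m)=\max\{\operatorname{WR}(f) : f \text{ is } r\text{-variate},\ \operatorname{DPD}(f)\le m\}$. Then for all $n,d,w\in\mathbb{N}$, \[ \mathsf{commROABP}(n,d,w)\subseteq \mathsf{diagROABP}\big(n,d,\,S(w^2,w^2)\cdot n\, w^4\big). \]
   Context: All polynomials are over $\mathbb{C}$, in variables $x_1,\dots,x_n$. A commutative ROABP of width $w$ computing an $n$-variate polynomial of individual degree $d$ is an expression $f(\mathbf{x})=\mathbf{u}^{T}\Big(\prod_{i=1}^{n}\big(A_{i,0}+A_{i,1}x_i+\cdots+A_{i,d}x_i^{d}\big)\Big)\mathbf{v}$ with $\mathbf{u},\mathbf{v}\in\mathbb{C}^{w}$ and $w\times w$ complex matrices $A_{i,j}$ (the coefficient matrices) that all pairwise commute. $\mathsf{commROABP}(n,d,w)$ is the class of $n$-variate polynomials of individual degree at most $d$ computable by such a commutative ROABP of width $w$. A diagonal ROABP is the same kind of expression where all coefficient matrices $A_{i,j}$ are $w\times w$ diagonal matrices (equivalently, $f$ is a sum of $w$ products $\prod_{i=1}^n f_{j,i}(x_i)$ of univariate polynomials of degree at most $d$); $\mathsf{diagROABP}(n,d,w)$ is the class of $n$-variate polynomials of individual degree at most $d$ computable by a diagonal ROABP of width $w$. A depth-3 powering ($\Sigma\bigwedge\Sigma$)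 circuit of size $s$ computes $\sum_{i=1}^{s}\beta_i(a_{i,0}+a_{i,1}x_1+\cdots+a_{i,n}x_n)^{d_i}$ with $\beta_i,a_{i,j}\in\mathbb{C}$, $d_i\in\mathbb{N}$; the Waring rank $\operatorname{WR}(f)$ is the size of the smallest such circuit computing $f$. The dimension of partial derivatives $\operatorname{DPD}(f)$ is $\dim_{\mathbb{C}}\operatorname{span}\{\partial^{|\mathbf{e}|}f/\partial x_1^{e_1}\cdots\partial x_n^{e_n} : \mathbf{e}\in\mathbb{N}^n\}$ (including $f$ itself, $\mathbf{e}=0$).
   Formalization: The formal theorem assumes n ≥ 1: for n = 0 the claimed width S(w²,w²)·n·w⁴ is 0, which computes only the zero polynomial, while a commutative ROABP of width 1 in no variables computes nonzero constants. *)

(* Defs.v *)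
From mathcomp Require Import all_boot all_order all_algebra.
From mathcomp Require Import mpoly.
From mathcomp Require Import boolp classical_sets reals.
From mathcomp Require Import complex.

Set Implicit Arguments.
Unset Strict Implicit.
Unset Printing Implicit Defensive.

Import GRing.Theory.

Local Open Scope ring_scope.
Local Open Scope classical_set_scope.

(* Junk value 0 when P is empty. *)
Definition least (P : set nat) : nat :=
  xget 0%N [set s | P s /\ forall t, P t -> (s <= t)%N].

Section Dimension.
Variables (K : fieldType) (V : lmodType K).

Definition linspan (A : set V) : set V :=
  [set v | exists (k : nat) (c : 'I_k -> K) (g : 'I_k -> V),
     (forall i, A (g i)) /\ v = \sum_(i < k) c i *: g i].

Definition is_basis (k : nat) (b : 'I_k -> V) (U : set V) : Prop :=
  [/\ forall i, U (b i),
      forall c : 'I_k -> K, \sum_(i < k) c i *: b i = 0 -> forall i, c i = 0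
    & forall v, U v -> exists c : 'I_k -> K, v = \sum_(i < k) c i *: b i].

(* Junk value 0 when U has no finite basis. *)
Definition dim (U : set V) : nat :=
  xget 0%N [set k | exists b : 'I_k -> V, is_basis b U].

End Dimension.

Section Classes.
Variable K : fieldType.

Definition indiv_degree_le (n d : nat) (f : {mpoly K[n]}) : Prop :=
  forall m : 'X_{1..n}, m \in msupp f -> forall i : 'I_n, (m i <= d)%N.

Definition roabp_layer (n d w : nat) (A : 'I_n -> 'I_d.+1 -> 'M[K]_w)
    (i : 'I_n) : 'M[{mpoly K[n]}]_w :=
  \sum_(j < d.+1) ('X_i ^+ j) *: map_mx (@mpolyC n K) (A i j).

(* The product is taken in the matrix ring, from i = 0 to i = n - 1. *)
Definition roabp_poly (n d w : nat) (u v : 'cV[K]_w)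
    (A : 'I_n -> 'I_d.+1 -> 'M[K]_w) : {mpoly K[n]} :=
  (map_mx (@mpolyC n K) u^T *m (\prod_(i < n) roabp_layer A i)
     *m map_mx (@mpolyC n K) v) 0 0.

Definition commROABP (n d w : nat) : set {mpoly K[n]} :=
  [set f | indiv_degree_le d f /\
     exists (u v : 'cV[K]_w) (A : 'I_n -> 'I_d.+1 -> 'M[K]_w),
       (forall i j k l, comm_mx (A i j) (A k l)) /\ f = roabp_poly u v A].

Definition diagROABP (n d w : nat) : set {mpoly K[n]} :=
  [set f | indiv_degree_le d f /\
     exists (u v : 'cV[K]_w) (A : 'I_n -> 'I_d.+1 -> 'M[K]_w),
       (forall i j, is_diag_mx (A i j)) /\ f = roabp_poly u v A].

Definition powering_circuit (n s : nat) (f : {mpoly K[n]}) : Prop :=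
  exists (beta a0 : 'I_s -> K) (a : 'I_s -> 'I_n -> K) (e : 'I_s -> nat),
    f = \sum_(i < s)
          beta i *: ((a0 i)%:MP + \sum_(j < n) a i j *: 'X_j) ^+ e i.

Definition WR (n : nat) (f : {mpoly K[n]}) : nat :=
  least [set s | powering_circuit s f].

Definition DPD (n : nat) (f : {mpoly K[n]}) : nat :=
  dim (linspan (range (fun e : 'X_{1..n} => f^`M[e]))).

(* Least upper bound of WR f over the r-variate f with DPD f <= m, i.e. the
   maximum when these values are bounded (f = 0 always qualifies). *)
Definition SWR (r m : nat) : nat :=
  least [set s | forall f : {mpoly K[r]}, (DPD f <= m)%N -> (WR f <= s)%N].

End Classes.

Arguments commROABP K n d w _ : clear implicits.
Arguments diagROABP K n d w _ : clear implicits.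
Arguments SWR K r m : clear implicits.

(* Main.v *)
(** The coefficient of [x^j] in a commutative ROABP is
    [T(j) = u^T (A_{1,j_1} ... A_{n,j_n}) v], and a diagonal ROABP of width [W]
    is a decomposition of this tensor into [W] product tensors.  Splitting the
    identity into at most [w] idempotents that commute with all the [A_{i,j}],
    one may assume that each [A_{i,j}] is a scalar plus a nilpotent matrix and
    then, by multilinearity, that [A_{i,j} = 1 + N_{i,j}] with nilpotent
    [N_{i,j}].  Write [1 + N_{i,j} = exp (sum_k c_{ijk} B_k)] with [w^2]
    commuting matrices [B_k].  Then [T(j) = F (sum_i c_{i,j_i})] for the
    polynomial [F(t) = u^T exp (sum_k t_k B_k) v], whose derivatives
    [u^T B^e exp (sum_k t_k B_k) v] span a space of dimension at most [w^2].
    A powering circuit for [F] expresses [T(j)] as a sum of univariate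
    polynomials of degree less than [w] in quantities [sum_i g_i(j_i)], and
    each of them is a sum of [n w] products, by interpolation of
    [prod_i exp (z g_i)] in [z].  Finally [S(r, m)] is a genuine maximum: a
    polynomial with [DPD f <= m] has individual degrees below [m], so it is a
    combination of finitely many monomials, each a sum of powers. *)
Require Import Defs.
From mathcomp Require Import all_boot all_order all_algebra.
From mathcomp Require Import mpoly.
From mathcomp Require Import boolp classical_sets reals.
From mathcomp Require Import complex.
From mathcomp Require Import ring.

Set Implicit Arguments.
Unset Strict Implicit.
Unset Printing Implicit Defensive.

Import Order.TTheory GRing.Theory Num.Theory.

Local Open Scope ring_scope.
Local Open Scope classical_set_scope.

(** * Truncated exponentials and interpolation *)

(** A finite sum makes the exponential available in every algebra; it is the full exponential on
    elements whose [L]-th power vanishes. *)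
Definition truncexp (K : numFieldType) (A : algType K) (L : nat) (x : A) : A :=
  \sum_(a < L) (a`!)%:R^-1 *: x ^+ a.

Lemma factr_neq0 (K : numFieldType) (a : nat) : (a`!)%:R != 0 :> K.
Proof. by rewrite pnatr_eq0 -lt0n fact_gt0. Qed.

Lemma binr_fact (K : numFieldType) (e i : nat) : (i <= e)%N ->
  (e`!)%:R^-1 * 'C(e, i)%:R = ((e - i)`!)%:R^-1 * (i`!)%:R^-1 :> K.
Proof.
move=> ie; rewrite -(bin_fact ie) !natrM !invfM.
rewrite mulrAC mulVf ?mul1r; first by rewrite mulrC.
by rewrite pnatr_eq0 -lt0n bin_gt0.
Qed.

(** The binomial theorem accounts for all terms of total degree below [L]. The rest is kept
    explicit: it vanishes for nilpotent arguments and is divisible by [X^L] for polynomial multiples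
    of [X]. *)
Lemma truncexpD (K : numFieldType) (A : algType K) (L : nat) (x y : A) :
  GRing.comm x y ->
  truncexp L x * truncexp L y = truncexp L (x + y) +
    \sum_(a < L) \sum_(b < L | (L <= a + b)%N)
      ((a`!)%:R^-1 * (b`!)%:R^-1) *: (x ^+ a * y ^+ b).
Proof.
move=> cxy; rewrite /truncexp big_distrlr /=.
transitivity (\sum_(a < L) (\sum_(b < L | (a + b < L)%N)
      ((a`!)%:R^-1 * (b`!)%:R^-1) *: (x ^+ a * y ^+ b) +
    \sum_(b < L | (L <= a + b)%N)
      ((a`!)%:R^-1 * (b`!)%:R^-1) *: (x ^+ a * y ^+ b))).
  apply: eq_bigr => a _; rewrite (bigID (fun b : 'I_L => (a + b < L)%N)) /=.
  congr (_ + _); first by apply: eq_bigr => b _; rewrite -scalerAl -scalerAr scalerA.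
  apply: eq_big => [b|b _]; first by rewrite -leqNgt.
  by rewrite -scalerAl -scalerAr scalerA.
rewrite big_split /=; congr (_ + _).
(* The guard [a + b < L] becomes a sum over the total degree [e], so that the sums can be regrouped
   by [e]. *)
have tri (a b : 'I_L) (z : A) :
    (if (a + b < L)%N then z else 0) = \sum_(e < L | (a + b)%N == e :> nat) z.
  case: ltnP => ab.
    by rewrite (big_pred1 (Ordinal ab)).
  rewrite big_pred0 // => e; apply/eqP => abe.
  by move: (ltn_ord e); rewrite -abe ltnNge ab.
under eq_bigr do rewrite big_mkcond.
under eq_bigr => a _ do under eq_bigr => b _ do rewrite tri.
under eq_bigr do rewrite (exchange_big_dep predT) //=.
rewrite (exchange_big_dep xpredT) //=; apply: eq_bigr => e _.
rewrite (exchange_big_dep xpredT) //= exprDn_comm // scaler_sumr.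
rewrite (big_ord_widen L (fun i : nat => (e`!)%:R^-1 *:
   (x ^+ (e - i) * y ^+ i *+ 'C(e, i)))) ?ltn_ord // [RHS]big_mkcond /=.
apply: eq_bigr => b _; rewrite ltnS; case: leqP => be; last first.
  rewrite big_pred0 // => a; apply/eqP => abe.
  by move: be; rewrite -abe ltnNge leq_addl.
have ebL : (e - b < L)%N by apply: leq_ltn_trans (leq_subr _ _) (ltn_ord e).
rewrite (big_pred1 (Ordinal ebL)) => [|a].
  by rewrite -scaler_nat scalerA binr_fact.
by rewrite -{1}(subnK be) eqn_add2r.
Qed.

Lemma truncexp0 (K : numFieldType) (A : algType K) (L : nat) :
  (0 < L)%N -> truncexp L 0 = 1 :> A.
Proof.
case: L => // L _; rewrite /truncexp big_ord_recl /= expr0 fact0 invr1 scale1r.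
by rewrite big1 ?addr0 // => i _; rewrite expr0n /= scaler0.
Qed.

Lemma truncexp_nil (K : numFieldType) (A : algType K) (w L : nat) (x : A) :
  x ^+ w = 0 -> (w <= L)%N -> truncexp L x = truncexp w x.
Proof.
move=> xw wL; rewrite /truncexp.
rewrite [RHS](big_ord_widen L (fun i : nat => (i`!)%:R^-1 *: x ^+ i)) //.
rewrite [RHS]big_mkcond; apply: eq_bigr => i _; case: ltnP => // wi.
by rewrite -(subnK wi) exprD xw mulr0 scaler0.
Qed.

Lemma truncexpD_nil (K : numFieldType) (A : algType K) (w : nat) (x y : A) :
  GRing.comm x y -> x ^+ w = 0 -> y ^+ w = 0 -> (x + y) ^+ w = 0 ->
  truncexp w (x + y) = truncexp w x * truncexp w y.
Proof.
move=> cxy xw yw xyw.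
(* Truncating at [w + w] changes nothing here, and [a + b >= w + w] forces [a >= w] or [b >= w],
   which kills the remainder. *)
have wL : (w <= w + w)%N by rewrite leq_addr.
rewrite -!(truncexp_nil _ wL) // truncexpD // -[LHS]addr0.
congr (_ + _); apply/esym/big1 => a _; apply: big1 => b Lab; have [wa|aw] := leqP w a.
  by rewrite -(subnK wa) exprD xw mulr0 mul0r scaler0.
have wb : (w <= b)%N.
  by rewrite -(leq_add2l w) (leq_trans Lab) // leq_add2r ltnW.
by rewrite -(subnK wb) exprD yw !mulr0 scaler0.
Qed.

(** Nilpotency is asked of all linear combinations because adding commuting nilpotents may raise the
    index; this way every partial sum keeps the same [w]. *)
Lemma truncexp_sum (K : numFieldType) (A : algType K) (w n : nat)
    (y : 'I_n -> A) :
  (0 < w)%N -> (forall i j, GRing.comm (y i) (y j)) ->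
  (forall c : 'I_n -> K, (\sum_i c i *: y i) ^+ w = 0) ->
  truncexp w (\sum_i y i) = \prod_i truncexp w (y i).
Proof.
move=> w0; elim: n y => [|n IHn] y cy yw; first by rewrite !big_ord0 truncexp0.
have yw0 : y ord0 ^+ w = 0.
  rewrite -[RHS](yw (fun i => (i == ord0)%:R)) (bigD1 ord0) //= scale1r.
  by rewrite big1 ?addr0 // => i /negPf ->; rewrite scale0r.
have yw1 (c : 'I_n -> K) : (\sum_i c i *: y (lift ord0 i)) ^+ w = 0.
  rewrite -[RHS](yw (fun i => if unlift ord0 i is Some j then c j else 0)).
  rewrite big_ord_recl unlift_none scale0r add0r; congr (_ ^+ _).
  by apply: eq_bigr => i _; rewrite liftK.
rewrite !big_ord_recl -IHn //.
rewrite truncexpD_nil //.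
- by apply: commr_sum => i _; apply: cy.
- by rewrite -[RHS](yw1 (fun=> 1)); under [in RHS]eq_bigr do rewrite scale1r.
- rewrite -[RHS](yw (fun=> 1)); under [in RHS]eq_bigr do rewrite scale1r.
  by rewrite big_ord_recl.
Qed.

Lemma truncexpD_dvdX (K : numFieldType) (L : nat) (p q : {poly K}) :
  exists r, truncexp L ('X * p) * truncexp L ('X * q) =
    truncexp L ('X * (p + q)) + 'X^L * r.
Proof.
have E a b : (L <= a + b)%N -> ('X * p) ^+ a * ('X * q) ^+ b =
    'X^L * ('X^(a + b - L) * (p ^+ a * q ^+ b)).
  by move=> Lab; rewrite !exprMn mulrACA -exprD [RHS]mulrA -exprD subnKC.
have [r Er] : exists r : {poly K}, \sum_(a < L) \sum_(b < L | (L <= a + b)%N)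
    ((a`!)%:R^-1 * (b`!)%:R^-1) *: (('X * p) ^+ a * ('X * q) ^+ b) = 'X^L * r.
  exists (\sum_(a < L) \sum_(b < L | (L <= a + b)%N)
    ((a`!)%:R^-1 * (b`!)%:R^-1) *: ('X^(a + b - L) * (p ^+ a * q ^+ b))).
  rewrite mulr_sumr; apply: eq_bigr => a _.
  rewrite mulr_sumr; apply: eq_bigr => b Lab.
  by rewrite -scalerAr -E.
by exists r; rewrite truncexpD ?mulrDr ?Er //; apply: mulrC.
Qed.

Lemma truncexp_XM (K : numFieldType) (L : nat) (p : {poly K}) : (1 < L)%N ->
  exists r, truncexp L ('X * p) = 1 + 'X * p + ('X * p) ^+ 2 * r.
Proof.
case: L => [|[|L]] // _.
exists (\sum_(i < L) ((i.+2)`!)%:R^-1 *: ('X * p) ^+ i).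
rewrite /truncexp !big_ord_recl /= !expr0 expr1 invr1 !scale1r -addrA.
congr (_ + (_ + _)); rewrite mulr_sumr; apply: eq_bigr => i _.
by rewrite -scalerAr -exprD.
Qed.

(* Hensel lifting: if [exp y = 1 + X + X^k c] then
   [exp (y - X^k c) = 1 + X + O(X^k.+1)]. *)
Lemma polylog (K : numFieldType) (w : nat) :
  exists q r : {poly K}, truncexp w ('X * q) = 1 + 'X + 'X^w * r.
Proof.
case: w => [|w].
  exists 0, (- (1 + 'X)); rewrite mulr0 expr0 mul1r subrr.
  by rewrite /truncexp big_ord0.
case: w => [|w].
  exists 0, (-1); rewrite mulr0 truncexp0 // mulrN1 addrK //.
set L := w.+2.
have H k : (k <= w.+1)%N ->
   exists q r : {poly K}, truncexp L ('X * q) = 1 + 'X + 'X^(k.+1) * r.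
  elim: k => [|k IHk] kw.
    by exists 0, (-1); rewrite mulr0 truncexp0 // expr1 mulrN1 addrK.
  have [q [c Eq]] := IHk (ltnW kw).
  have [r1 Er1] := @truncexpD_dvdX K L q (- ('X^k * c)).
  have [r2 Er2] := @truncexp_XM K L (- ('X^k * c)) isT.
  set x := 'X^(k.+1) * c; have Ex : 'X * - ('X^k * c) = - x.
    by rewrite mulrN mulrA -exprS.
  exists (q - 'X^k * c), (c * (- 1 - 'X^k * c)
    + 'X^k * (c ^+ 2 * r2 * (1 + 'X + x)) - 'X^(w - k) * r1).
  apply: (addIr ('X^L * r1)); rewrite -Er1 Eq Er2 Ex -/x.
  rewrite sqrrN /x exprMn -!exprM.
  (* As [k.+2 <= L], the truncation error [X^L r1] is absorbed into the new remainder. *)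
  have -> : 'X^L = 'X^(k.+2) * 'X^(w - k) :> {poly K}.
    by rewrite -exprD /L; congr (_ ^+ _); rewrite !addSn subnKC.
  rewrite muln2 -addnn addSn addnS !exprS !exprD.
  set z : {poly K} := 'X^k; set z' : {poly K} := 'X^(w - k).
  by ring.
have [q [r Er]] := H w.+1 (leqnn _); by exists q, r.
Qed.

Lemma horner_mx_truncexp (K : numFieldType) (w L : nat) (N : 'M[K]_w.+1)
    (p : {poly K}) :
  horner_mx N (truncexp L p) = truncexp L (horner_mx N p).
Proof.
rewrite /truncexp rmorph_sum /=; apply: eq_bigr => a _.
by rewrite horner_mxZ rmorphXn.
Qed.

(** Substituting [N] for [X] in the truncated logarithm kills its error term. The logarithm is a
    polynomial in [N], so it inherits commutation and nilpotency from [N]. *)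
Lemma nilmx_log (K : numFieldType) (w L : nat) :
  exists q : {poly K}, forall N : 'M[K]_w.+1, N ^+ L = 0 ->
    truncexp L (N * horner_mx N q) = 1 + N.
Proof.
have [q [r E]] := polylog K L.
exists q => N NL; move/(congr1 (horner_mx N)): E.
rewrite horner_mx_truncexp !rmorphD !rmorphM /= rmorph1 rmorphXn /=.
by rewrite horner_mx_X NL mul0r addr0.
Qed.

(** The inverse Vandermonde matrix at the nodes [0, ..., N-1], distinct in characteristic zero,
    recovers the coefficients of a polynomial of size at most [N] from its values. *)
Lemma vandermonde_dual (K : numFieldType) (N : nat) :
  exists om : 'I_N -> 'I_N -> K, forall e j : 'I_N,
    \sum_(l < N) om e l * l%:R ^+ j = (e == j)%:R.
Proof.
pose V : 'M[K]_N := Vandermonde N (\row_l (l : nat)%:R).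
have Vu : V \in unitmx.
  rewrite unitmxE det_Vandermonde unitfE; apply/prodf_neq0 => i _.
  apply/prodf_neq0 => j ij; rewrite !mxE subr_eq0 eqr_nat.
  by rewrite gtn_eqF.
exists (fun e l => invmx V l e) => e j.
transitivity ((V *m invmx V) j e); last by rewrite mulmxV // mxE eq_sym.
by rewrite mxE; apply: eq_bigr => l _; rewrite !mxE mulrC.
Qed.

(** * Sums of products and the rank of coefficient tensors *)

Lemma prod_truncexp_X (K : numFieldType) (n w : nat) (g : 'I_n -> K) :
  (0 < w)%N -> exists r, \prod_i truncexp w ('X * (g i)%:P) =
    truncexp w ('X * (\sum_i g i)%:P) + 'X^w * r.
Proof.
move=> w0; elim: n g => [|n IHn] g.
  by exists 0; rewrite !big_ord0 !mulr0 truncexp0 // addr0.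
have [r Er] := IHn (fun i => g (lift ord0 i)).
have [r' Er'] := truncexpD_dvdX w (g ord0)%:P (\sum_i g (lift ord0 i))%:P.
exists (r' + truncexp w ('X * (g ord0)%:P) * r).
rewrite !big_ord_recl Er mulrDr Er' -polyCD -addrA; congr (_ + _).
by rewrite mulrDr; congr (_ + _); rewrite mulrCA.
Qed.

Lemma coef_truncexp_X (K : numFieldType) (w e : nat) (x : K) : (e < w)%N ->
  (truncexp w ('X * x%:P))`_e = (e`!)%:R^-1 * x ^+ e.
Proof.
move=> ew; rewrite /truncexp coef_sum (bigD1 (Ordinal ew)) //= big1 => [|i ie].
  by rewrite coefZ exprMn -rmorphXn coefMC coefXn eqxx mul1r addr0.
rewrite coefZ exprMn -rmorphXn coefMC coefXn eq_sym.
by move: ie; rewrite -val_eqE => /negPf /= ->; rewrite mul0r mulr0.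
Qed.

Lemma size_truncexp_X (K : numFieldType) (w : nat) (x : K) :
  (size (truncexp w ('X * x%:P)) <= w)%N.
Proof.
apply: (leq_trans (size_sum _ _ _)); apply/bigmax_leqP => i _.
apply: (leq_trans (size_scale_leq _ _)); rewrite exprMn -rmorphXn mulrC mul_polyC.
by apply: (leq_trans (size_scale_leq _ _)); rewrite size_polyXn ltn_ord.
Qed.

(* The coefficients of order [< w] of [prod_i exp (g_i X)] are those of
   [exp ((sum_i g_i) X)]; interpolation recovers them from values. *)
Lemma horner_sum_products (K : numFieldType) (n w : nat) (p : {poly K}) :
  (0 < n)%N -> (0 < w)%N -> (size p <= w)%N ->
  exists (c : 'I_(n * w) -> K) (q : 'I_(n * w) -> K -> K),
    forall g : 'I_n -> K, p.[\sum_i g i] = \sum_l c l * \prod_i q l (g i).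
Proof.
move=> n0 w0 pw; have [om Hom] := vandermonde_dual K (n * w).
have wnw : (w <= n * w)%N by rewrite leq_pmull.
(* [om] extracts the coefficient of degree [e] of the product of exponentials, and the factorial
   undoes the division by [e!]. The [n * w] nodes suffice since the product has degree at most
   [n * (w - 1)]. *)
exists (fun l => \sum_(e < w) p`_e * (e`!)%:R * om (widen_ord wnw e) l).
exists (fun l x => (truncexp w ('X * x%:P)).[l%:R]) => g.
pose H : {poly K} := \prod_i truncexp w ('X * (g i)%:P).
have HE (l : nat) : \prod_i (truncexp w ('X * (g i)%:P)).[l%:R] = H.[l%:R].
  by rewrite horner_prod.
have sH : (size H <= n * w)%N.
  apply: (leq_trans (size_poly_prod_leq _ _)).
  rewrite cardT size_enum_ord leq_subLR -add1n leq_add //.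
  rewrite -[X in (_ <= X * _)%N](card_ord n) -sum_nat_const.
  by apply: leq_sum => i _; apply: size_truncexp_X.
have Hc (e : nat) : (e < w)%N -> H`_e = (e`!)%:R^-1 * (\sum_i g i) ^+ e.
  move=> ew; have [r Er] := prod_truncexp_X g w0.
  by rewrite /H Er coefD coef_truncexp_X // coefXnM ew addr0.
rewrite (horner_coef_wide _ pw).
under [RHS]eq_bigr => l _ do rewrite HE mulr_suml.
rewrite exchange_big /=; apply: eq_bigr => e _.
under [RHS]eq_bigr => l _ do rewrite (horner_coef_wide _ sH) -(mulrA (_ * _)) mulr_sumr.
rewrite -mulr_sumr exchange_big /= [in RHS](bigD1 (widen_ord wnw e)) //=.
rewrite [X in _ + X]big1 => [|j je].
  rewrite addr0; under [in RHS]eq_bigr do rewrite mulrCA.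
  have /= HE1 := Hom (widen_ord wnw e) (widen_ord wnw e).
  rewrite -mulr_sumr HE1 eqxx mulr1 Hc // -mulrA; congr (_ * _).
  by rewrite mulrA mulfV ?mul1r ?factr_neq0.
under eq_bigr do rewrite mulrCA.
by rewrite -mulr_sumr Hom eq_sym (negPf je) mulr0.
Qed.

(** An upper bound on the canonical polyadic rank of [T], seen as a tensor of order [n]. *)
Definition cprank_le (K : fieldType) (n : nat) (J : finType) (W : nat)
    (T : ('I_n -> J) -> K) : Prop :=
  exists (c : 'I_W -> K) (h : 'I_W -> 'I_n -> J -> K),
    forall j, T j = \sum_s c s * \prod_i h s i (j i).

Lemma cprank_fin (K : fieldType) (n : nat) (J S : finType)
    (T : ('I_n -> J) -> K) (c : S -> K) (h : S -> 'I_n -> J -> K) :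
  (forall j, T j = \sum_s c s * \prod_i h s i (j i)) -> cprank_le #|S| T.
Proof.
move=> E; exists (fun s => c (enum_val s)), (fun s => h (enum_val s)) => j.
rewrite E (reindex (fun s : 'I_#|S| => enum_val s)) //=.
by apply: onW_bij; apply: enum_val_bij.
Qed.

Lemma cprankD (K : fieldType) (n : nat) (J : finType) (W1 W2 : nat)
    (T1 T2 : ('I_n -> J) -> K) :
  cprank_le W1 T1 -> cprank_le W2 T2 ->
  cprank_le (W1 + W2) (fun j => T1 j + T2 j).
Proof.
move=> [c1 [h1 E1]] [c2 [h2 E2]].
rewrite -[X in (X + _)%N]card_ord -[X in (_ + X)%N]card_ord -card_sum.
apply: (cprank_fin
  (c := fun s => match s with inl a => c1 a | inr b => c2 b end)
  (h := fun s => match s with inl a => h1 a | inr b => h2 b end)) => j.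
by rewrite big_sumType /= E1 E2.
Qed.

Lemma cprank_widen (K : fieldType) (n : nat) (J : finType) (W1 W2 : nat)
    (T : ('I_n -> J) -> K) :
  (W1 <= W2)%N -> cprank_le W1 T -> cprank_le W2 T.
Proof.
move=> W12 TW.
have T0 : cprank_le (W2 - W1) (fun _ : 'I_n -> J => 0 : K).
  by exists (fun=> 0), (fun _ _ _ => 0) => j; rewrite big1 // => s _; rewrite mul0r.
have [c [h E]] := cprankD TW T0; rewrite subnKC // in c h E.
by exists c, h => j; rewrite -E addr0.
Qed.

Lemma cprank_ext (K : fieldType) (n : nat) (J : finType) (W : nat)
    (T1 T2 : ('I_n -> J) -> K) :
  T1 =1 T2 -> cprank_le W T1 -> cprank_le W T2.
Proof. by move=> E [c [h H]]; exists c, h => j; rewrite -E. Qed.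

Definition bilin (K : fieldType) (w : nat) (u v : 'cV[K]_w) (M : 'M[K]_w) : K :=
  (u^T *m M *m v) 0 0.

Lemma bilin_sum (K : fieldType) (w : nat) (u v : 'cV[K]_w) (I : Type)
    (r : seq I) (P : pred I) (F : I -> 'M[K]_w) :
  bilin u v (\sum_(i <- r | P i) F i) = \sum_(i <- r | P i) bilin u v (F i).
Proof. by rewrite /bilin mulmx_sumr mulmx_suml summxE. Qed.

Lemma bilinZ (K : fieldType) (w : nat) (u v : 'cV[K]_w) (a : K) (M : 'M[K]_w) :
  bilin u v (a *: M) = a * bilin u v M.
Proof. by rewrite /bilin -scalemxAr -scalemxAl mxE. Qed.

Lemma prod_scalemx (R : comPzRingType) (w n : nat) (a : 'I_n -> R)
    (M : 'I_n -> 'M[R]_w) :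
  \prod_i (a i *: M i) = (\prod_i a i) *: \prod_i M i.
Proof.
elim: n a M => [|n IHn] a M; first by rewrite !big_ord0 scale1r.
by rewrite !big_ord_recl IHn -[_ * _]scalemxAl -[_ *m _]scalemxAr scalerA.
Qed.

(** By multilinearity, a linear change of index in each mode acts on the factors of a product tensor
    one by one, so the number of products stays the same. *)
Lemma cprank_contract (K : fieldType) (n w W : nat) (J J' : finType)
    (u v : 'cV[K]_w) (M : 'I_n -> J' -> 'M[K]_w) (gam : 'I_n -> J -> J' -> K) :
  cprank_le W (fun j => bilin u v (\prod_i M i (j i))) ->
  cprank_le W (fun j => bilin u v (\prod_i \sum_k gam i (j i) k *: M i k)).
Proof.
move=> [c [h E]]; exists c, (fun s i j => \sum_k gam i j k * h s i k) => j.
rewrite bigA_distr_bigA bilin_sum.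
under [RHS]eq_bigr => s _ do rewrite bigA_distr_bigA mulr_sumr.
rewrite exchange_big /=; apply: eq_bigr => f _.
rewrite prod_scalemx bilinZ E mulr_sumr; apply: eq_bigr => s _.
by rewrite big_split /= mulrCA.
Qed.

Lemma roabp_polyE (K : fieldType) (n d w : nat) (u v : 'cV[K]_w)
    (A : 'I_n -> 'I_d.+1 -> 'M[K]_w) :
  roabp_poly u v A = \sum_(j : {ffun 'I_n -> 'I_d.+1})
    bilin u v (\prod_i A i (j i)) *: \prod_i 'X_i ^+ j i.
Proof.
rewrite /roabp_poly /roabp_layer bigA_distr_bigA mulmx_sumr mulmx_suml summxE.
apply: eq_bigr => j _; rewrite prod_scalemx -scalemxAr -scalemxAl mxE.
have -> : \prod_i map_mx (@mpolyC n K) (A i (j i)) =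
    map_mx (@mpolyC n K) (\prod_i A i (j i)).
  elim/big_ind2: _ => [|M1 M2 N1 N2 -> ->|//]; first by rewrite map_mx1.
  by rewrite -[LHS]map_mxM.
by rewrite -!map_mxM mxE mulrC mul_mpolyC.
Qed.

Lemma cprank_diag (K : fieldType) (n d W : nat)
    (T : ('I_n -> 'I_d.+1) -> K) : cprank_le W T ->
  exists (u v : 'cV[K]_W) (A : 'I_n -> 'I_d.+1 -> 'M[K]_W),
    (forall i j, is_diag_mx (A i j)) /\
    forall j, T j = bilin u v (\prod_i A i (j i)).
Proof.
(* Each diagonal position carries one product tensor; the weights sit in [u] and the all-ones [v]
   adds up the positions. *)
move=> [c [h E]]; exists (\col_s c s), (const_mx 1).
exists (fun i j => diag_mx (\row_s h s i j)).
split=> [i j|j]; first exact: diag_mx_is_diag.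
have -> : \prod_i diag_mx (\row_s h s i (j i)) =
    diag_mx (\row_s \prod_i h s i (j i)).
  elim: (index_enum _) => [|i r IHr].
    rewrite big_nil; apply/matrixP => s t; rewrite !mxE big_nil.
    by case: eqP.
  rewrite big_cons IHr [LHS]mulmx_diag; congr diag_mx; apply/rowP => s.
  by rewrite !mxE big_cons.
rewrite E /bilin mul_mx_diag mxE; apply: eq_bigr => s _.
by rewrite !mxE mulr1.
Qed.

(** * Finiteness of S(r, m) *)

Lemma leastP (P : set nat) : (exists s, P s) ->
  P (least P) /\ forall t, P t -> (least P <= t)%N.
Proof.
move=> [s Ps]; have ex : exists s, `[< P s >] by exists s; apply/asboolP.
suff: exists x, P x /\ forall t, P t -> (x <= t)%N by exact: xgetPex.
case: (ex_minnP ex) => k /asboolP Pk kmin; exists k; split=> // t Pt.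
by apply: kmin; apply/asboolP.
Qed.

(** * Independent families, spanning families and dimension *)

Section LinearAlgebra.
Variables (K : fieldType) (V : lmodType K).

Definition lin_indep (p : nat) (b : 'I_p -> V) : Prop :=
  forall c : 'I_p -> K, \sum_i c i *: b i = 0 -> forall i, c i = 0.

Definition spanned_by (k : nat) (g : 'I_k -> V) (U : set V) : Prop :=
  forall v, U v -> exists c : 'I_k -> K, v = \sum_i c i *: g i.

Lemma lin_indep_le (p k : nat) (b : 'I_p -> V) (g : 'I_k -> V) (U : set V) :
  lin_indep b -> spanned_by g U -> (forall i, U (b i)) -> (p <= k)%N.
Proof.
move=> ib sg Ub; have /choice [c Ec] := fun i => sg _ (Ub i).
(* A vector in the left kernel of the coordinate matrix is a linear relation between the [b i]. *)
pose M : 'M[K]_(p, k) := \matrix_(i, j) c i j.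
suff: row_free M by rewrite /row_free => /eqP <-; apply: rank_leq_col.
rewrite -kermx_eq0; apply/eqP/row_matrixP => i; rewrite row0.
have kM : row i (kermx M) *m M = 0 by apply/sub_kermxP; apply: row_sub.
apply/rowP => j; rewrite [RHS]mxE; apply: (ib (fun j => row i (kermx M) 0 j)).
under eq_bigr => l _ do rewrite Ec scaler_sumr.
rewrite exchange_big /=; apply: big1 => l _.
under eq_bigr => l' _ do rewrite scalerA.
rewrite -scaler_suml (_ : \sum_(_ | _) _ = 0) ?scale0r //.
move/rowP/(_ l): kM; rewrite !mxE => kM; rewrite -[RHS]kM.
by apply: eq_bigr => l' _; rewrite !mxE.
Qed.

Lemma lin_indep_extend (p : nat) (b : 'I_p -> V) (v : V) :
  lin_indep b -> ~ (exists c : 'I_p -> K, v = \sum_i c i *: b i) ->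
  lin_indep (fun i : 'I_p.+1 => if unlift ord0 i is Some j then b j else v).
Proof.
move=> ib nv c; rewrite big_ord_recl unlift_none.
under eq_bigr => i _ do rewrite liftK.
have [c0 E|c0 E] := eqVneq (c ord0) 0.
  move=> i; case: (unliftP ord0 i) => [j ->|-> //].
  by apply: (ib (fun j => c (lift ord0 j))); rewrite -[RHS]E c0 scale0r add0r.
case: nv; exists (fun j => - (c ord0)^-1 * c (lift ord0 j)).
under eq_bigr do rewrite -scalerA.
rewrite -scaler_sumr; apply: (scalerI c0); rewrite scalerA mulrN mulfV //.
by rewrite scaleN1r; apply/eqP; rewrite -addr_eq0 E.
Qed.

Lemma dim_le (k : nat) (g : 'I_k -> V) (U : set V) :
  spanned_by g U -> (Defs.dim U <= k)%N.
Proof.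
move=> sg; rewrite /Defs.dim; case: xgetP => [p _ [b [Ub ib _]]|_] //.
exact: lin_indep_le ib sg Ub.
Qed.

(** The finite spanning family bounds the size of independent families in [U], so a largest one
    exists and is a basis; hence [dim] is not at its default value. *)
Lemma dim_ge (p k : nat) (b : 'I_p -> V) (g : 'I_k -> V) (U : set V) :
  spanned_by g U -> lin_indep b -> (forall i, U (b i)) -> (p <= Defs.dim U)%N.
Proof.
move=> sg ib Ub.
suff: exists q, exists b' : 'I_q -> V, is_basis b' U.
  move/(@xgetPex _ 0%N) => [b' [Ub' ib' sb']]; exact: lin_indep_le ib sb' Ub.
pose P q := `[< exists b' : 'I_q -> V, (forall i, U (b' i)) /\ lin_indep b' >].
have exP : exists q, P q by exists p; apply/asboolP; exists b.
have ubP q : P q -> (q <= k)%N.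
  by move/asboolP => [b' [Ub' ib']]; apply: lin_indep_le ib' sg Ub'.
case: (ex_maxnP exP ubP) => q /asboolP [b' [Ub' ib']] qmax.
exists q, b'; split=> // v Uv; apply: contrapT => nv.
suff /qmax: P q.+1 by rewrite ltnn.
apply/asboolP; eexists; split; last exact: lin_indep_extend ib' nv.
by move=> i /=; case: unlift.
Qed.

Lemma spanned_linspan (k : nat) (g : 'I_k -> V) (A : set V) :
  spanned_by g A -> spanned_by g (linspan A).
Proof.
move=> sg v [q [c [a [Aa ->]]]]; have /choice [e Ee] := fun i => sg _ (Aa i).
exists (fun j => \sum_i c i * e i j).
under eq_bigr => i _ do rewrite Ee scaler_sumr.
rewrite exchange_big /=; apply: eq_bigr => j _.
by rewrite scaler_suml; apply: eq_bigr => i _; rewrite scalerA.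
Qed.

Lemma linspan_in (A : set V) (v : V) : A v -> linspan A v.
Proof.
move=> Av; exists 1%N, (fun=> 1), (fun=> v); split=> //.
by rewrite big_ord1 scale1r.
Qed.

End LinearAlgebra.

(** * Powering circuits for monomials, and degree bounds from derivatives *)

Section Waring.
Variables (K : numFieldType) (n : nat).
Implicit Types f g : {mpoly K[n]}.

Let aff (a0 : K) (a : 'I_n -> K) : {mpoly K[n]} :=
  a0%:MP + \sum_(j < n) a j *: 'X_j.

Lemma powering_circuit_fin (S : finType) f (beta a0 : S -> K)
    (a : S -> 'I_n -> K) (e : S -> nat) :
  f = \sum_s beta s *: (aff (a0 s) (a s)) ^+ e s -> powering_circuit #|S| f.
Proof.
move=> ->; exists (beta \o enum_val), (a0 \o enum_val).
exists (a \o enum_val), (e \o enum_val).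
rewrite (reindex (fun s : 'I_#|S| => enum_val s)) //=.
by apply: onW_bij; apply: enum_val_bij.
Qed.

Lemma powering_circuitD s1 s2 f g :
  powering_circuit s1 f -> powering_circuit s2 g ->
  powering_circuit (s1 + s2) (f + g).
Proof.
move=> [b1 [c1 [a1 [e1 ->]]]] [b2 [c2 [a2 [e2 ->]]]].
rewrite -[X in (X + _)%N]card_ord -[X in (_ + X)%N]card_ord -card_sum.
apply: (powering_circuit_fin
  (beta := fun s => match s with inl x => b1 x | inr y => b2 y end)
  (a0 := fun s => match s with inl x => c1 x | inr y => c2 y end)
  (a := fun s => match s with inl x => a1 x | inr y => a2 y end)
  (e := fun s => match s with inl x => e1 x | inr y => e2 y end)).
by rewrite big_sumType.
Qed.

Lemma powering_circuit0 s : powering_circuit s (0 : {mpoly K[n]}).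
Proof.
exists (fun=> 0), (fun=> 0), (fun _ _ => 0), (fun=> 0%N).
by rewrite big1 // => i _; rewrite scale0r.
Qed.

Lemma powering_circuit_widen s t f :
  (s <= t)%N -> powering_circuit s f -> powering_circuit t f.
Proof.
move=> st sf; rewrite -[f]addr0 -(subnKC st).
exact: powering_circuitD sf (powering_circuit0 _).
Qed.

Lemma powering_circuitZ s (x : K) f :
  powering_circuit s f -> powering_circuit s (x *: f).
Proof.
move=> [b [c [a [e ->]]]]; exists (fun i => x * b i), c, a, e.
by rewrite scaler_sumr; apply: eq_bigr => i _; rewrite scalerA.
Qed.

Lemma powering_circuit_sum (I : finType) (s : I -> nat) (F : I -> {mpoly K[n]}) :
  (forall i, powering_circuit (s i) (F i)) ->
  powering_circuit (\sum_i s i) (\sum_i F i).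
Proof.
move=> H; elim: (index_enum I) => [|i r IHr].
  by rewrite !big_nil; apply: powering_circuit0.
by rewrite !big_cons; apply: powering_circuitD.
Qed.

(* [aff^a X_k^b] is, up to a binomial coefficient, the coefficient of [t^b] in
   [(aff + t X_k)^(a+b)], hence a combination of the values at [t = 0..a+b]. *)
Lemma powering_circuit_affM (a0 : K) (c : 'I_n -> K) (a b : nat) (k : 'I_n) :
  powering_circuit (a + b).+1 (aff a0 c ^+ a * 'X_k ^+ b).
Proof.
have [om Hom] := vandermonde_dual K (a + b).+1.
have bab : (b < (a + b).+1)%N by rewrite ltnS leq_addl.
pose B := Ordinal bab.
exists (fun l => ('C(a + b, b))%:R^-1 * om B l), (fun=> a0).
exists (fun l j => c j + l%:R * (j == k)%:R), (fun=> (a + b)%N).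
have affE (l : nat) : a0%:MP + \sum_(j < n) (c j + l%:R * (j == k)%:R) *: 'X_j =
    aff a0 c + l%:R *: 'X_k.
  rewrite /aff -addrA; congr (_ + _).
  under eq_bigr do rewrite scalerDl.
  rewrite big_split /=; congr (_ + _).
  rewrite (bigD1 k) //= eqxx mulr1 big1 ?addr0 // => j /negPf ->.
  by rewrite mulr0 scale0r.
under eq_bigr => l _ do rewrite affE exprDn scaler_sumr.
rewrite exchange_big /= (bigD1 B) //= [X in _ + X]big1 => [|j jB].
  rewrite addr0.
  under eq_bigr => l _ do rewrite addnK exprZn -scalerAr -scaler_nat !scalerA.
  rewrite -scaler_suml.
  rewrite (eq_bigr (fun l : 'I__ => ('C(a + b, b))%:R^-1 * ('C(a + b, b))%:R
    * (om B l * l%:R ^+ B))) => [|l _]; last by rewrite /=; ring.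
  rewrite -mulr_sumr Hom eqxx mulr1 mulVf ?scale1r // pnatr_eq0 -lt0n bin_gt0.
  by rewrite leq_addl.
under eq_bigr => l _ do rewrite exprZn -scalerAr -scaler_nat !scalerA.
rewrite -scaler_suml.
rewrite (eq_bigr (fun l : 'I__ => ('C(a + b, b))%:R^-1 * ('C(a + b, j))%:R
  * (om B l * l%:R ^+ j))) => [|l _]; last by rewrite /=; ring.
by rewrite -mulr_sumr Hom eq_sym (negPf jB) mulr0 scale0r.
Qed.

Lemma powering_circuit_mulX s f (k : 'I_n) (b : nat) :
  powering_circuit s f -> exists t, powering_circuit t (f * 'X_k ^+ b).
Proof.
move=> [be [c [a [e ->]]]]; eexists; rewrite mulr_suml.
apply: powering_circuit_sum => i; rewrite -scalerAl.
exact/powering_circuitZ/powering_circuit_affM.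
Qed.

Lemma powering_circuit_mono (m : 'X_{1..n}) :
  exists s, powering_circuit s ('X_[m] : {mpoly K[n]}).
Proof.
rewrite mpolyXE_id; elim: (index_enum _) => [|i r [s Hs]].
  rewrite big_nil; exists 1%N, (fun=> 1), (fun=> 1), (fun _ _ => 0), (fun=> 1%N).
  by rewrite big_ord1 scale1r big1 ?addr0 ?expr1 // => j _; rewrite scale0r.
by rewrite big_cons mulrC; apply: powering_circuit_mulX Hs.
Qed.

Let mbox (D : nat) (e : {ffun 'I_n -> 'I_D}) : 'X_{1..n} :=
  [multinom (e i : nat) | i < n].

Lemma mpoly_boxE (D : nat) f :
  (forall m, f@_m != 0 -> forall i, (m i < D)%N) ->
  f = \sum_(e : {ffun 'I_n -> 'I_D}) f@_(mbox e) *: 'X_[mbox e].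
Proof.
move=> fD; apply/mpolyP => m; rewrite raddf_sum /=.
under eq_bigr do rewrite mcoeffZ mcoeffX.
have [fm|fm] := eqVneq f@_m 0.
  rewrite fm big1 // => e _; case: eqP => [->|]; last by rewrite mulr0.
  by rewrite fm mul0r.
pose e := [ffun i => Ordinal (fD m fm i)].
have Ee : mbox e = m by apply/mnmP => i; rewrite mnmE ffunE.
rewrite (bigD1 e) //= Ee eqxx mulr1 big1 ?addr0 // => e' ne.
case: eqP => [E|]; last by rewrite mulr0.
case/eqP: ne; apply/ffunP => i; apply: val_inj.
by rewrite ffunE /= -E mnmE.
Qed.

(** One [B] serves every polynomial supported in the box, since all are combinations of the same
    monomials and scaling costs nothing. *)
Lemma powering_circuit_box (D : nat) :
  exists B, forall f, (forall m, f@_m != 0 -> forall i, (m i < D)%N) ->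
    powering_circuit B f.
Proof.
have /choice [s Hs] := fun e : {ffun 'I_n -> 'I_D} => powering_circuit_mono (mbox e).
exists (\sum_e s e)%N => f fD; rewrite (mpoly_boxE fD).
by apply: powering_circuit_sum => e; apply: powering_circuitZ.
Qed.

(** Differentiation only lowers exponents, so all derivatives stay in the box of monomials that
    contains the support of [f]. *)
Lemma mderiv_spanned f : exists k (g : 'I_k -> {mpoly K[n]}),
  spanned_by g (range (fun e : 'X_{1..n} => f^`M[e])).
Proof.
pose D := msize f.
have fD m : f@_m != 0 -> forall i, (m i < D)%N.
  rewrite -mcoeff_msupp => /msize_mdeg_lt mD i; apply: leq_ltn_trans mD.
  by rewrite mdegE (bigD1 i) //= leq_addr.
exists #|{ffun 'I_n -> 'I_D}|, (fun i => 'X_[mbox (enum_val i)]) => _ [e _ <-].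
have dD m : (f^`M[e])@_m != 0 -> forall i, (m i < D)%N.
  rewrite mcoeff_mderivm => fm i.
  have /fD/(_ i) : f@_(e + m) != 0.
    by apply: contraNneq fm => ->; rewrite mul0rn.
  by apply: leq_ltn_trans; rewrite mnmDE leq_addl.
exists (fun i => (f^`M[e])@_(mbox (enum_val i))).
rewrite [LHS](mpoly_boxE dD).
rewrite (reindex (fun s : 'I_#|{ffun 'I_n -> 'I_D}| => enum_val s)) //=.
by apply: onW_bij; apply: enum_val_bij.
Qed.

(* The derivatives [d^l f / dx_k^l] with [l <= deg_k f] are independent: order
   them by their degree in [x_k]. *)
Lemma indiv_degree_DPD f (m : 'X_{1..n}) (k : 'I_n) :
  f@_m != 0 -> (m k < DPD f)%N.
Proof.
move=> fm.
pose P D := has (fun m' : 'X_{1..n} => m' k == D) (msupp f).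
have Pm : P (m k) by apply/hasP; exists m => //; rewrite mcoeff_msupp.
have exP : exists D, P D by exists (m k).
have ubP D : P D -> (D <= msize f)%N.
  case/hasP => m' /msize_mdeg_lt mD /eqP <-; apply: ltnW; apply: leq_ltn_trans mD.
  by rewrite mdegE (bigD1 k) //= leq_addr.
(* [D] is the degree of [f] in [x_k], attained at the monomial [mu]. *)
case: (ex_maxnP exP ubP) => D /hasP[mu fmu /eqP muD] Dmax.
apply: leq_ltn_trans (Dmax _ Pm) _.
have [q [g sg]] := mderiv_spanned f.
apply: (dim_ge (b := fun l : 'I_D.+1 => f^`M[U_(k) *+ l]) (spanned_linspan sg));
  last by move=> i; apply: linspan_in; exists (U_(k) *+ i)%MM.
move=> c Ec.
have H (i : nat) (iD : (i < D.+1)%N) : c (Ordinal iD) = 0.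
  elim/ltn_ind: i iD => i IHi iD.
  have Uimu : (U_(k) *+ i <= mu)%MM.
    apply/mnm_lepP => j; rewrite mulmnE mnm1E; case: eqP => [<-|_] //.
    by rewrite mul1n muD.
  (* At the exponent [mu - i e_k], orders [l < i] drop out by induction, and an order [l > i] would
     require a monomial of [f] of degree [D - i + l > D] in [x_k]. *)
  move/(congr1 (mcoeff (mu - U_(k) *+ i))): Ec; rewrite mcoeff0 raddf_sum /=.
  rewrite (bigD1 (Ordinal iD)) //= big1 => [|l li].
    rewrite addr0 mcoeffZ mcoeff_mderivm addmC submK // => /eqP.
    rewrite mulf_eq0 mulrn_eq0 (negPf (_ : f@_mu != 0)) ?orbF -?mcoeff_msupp //.
    case/orP => [/eqP //|]; rewrite eqn0Ngt prodn_gt0 // => j.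
    by rewrite ffact_gt0; move/mnm_lepP: Uimu.
  have [lti|] := ltnP l i.
    have -> : l = Ordinal (ltn_trans lti iD) by apply: val_inj.
    by rewrite IHi // scale0r mcoeff0.
  rewrite leq_eqVlt => /orP[/eqP il|il].
    by case/eqP: li; apply: val_inj.
  rewrite mcoeffZ mcoeff_mderivm memN_msupp_eq0 ?mul0rn ?mulr0 //.
  apply/negP => nu; have /Dmax : P ((U_(k) *+ l + (mu - U_(k) *+ i))%MM k).
    by apply/hasP; eexists; first exact: nu.
  rewrite mnmDE mnmBE !mulmnE mnm1E eqxx !mul1n muD leqNgt => /negP; apply.
  by rewrite -[X in (X < _)%N](subnKC (iD : (i <= D)%N)) ltn_add2r.
by move=> [i iD]; apply: H.
Qed.

End Waring.

Lemma WRP (K : fieldType) (n s : nat) (f : {mpoly K[n]}) :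
  powering_circuit s f ->
  powering_circuit (WR f) f /\ forall t, powering_circuit t f -> (WR f <= t)%N.
Proof. by move=> H; apply: (leastP (P := fun t => powering_circuit t f)); exists s. Qed.

Lemma powering_circuit_SWR (K : numFieldType) (r m : nat) (f : {mpoly K[r]}) :
  (DPD f <= m)%N -> powering_circuit (SWR K r m) f.
Proof.
move=> fm; have [B HB] := @powering_circuit_box K r m.
have circ (g : {mpoly K[r]}) : (DPD g <= m)%N -> powering_circuit B g.
  move=> gm; apply: (HB g) => mu gmu i.
  by apply: leq_trans gm; apply: indiv_degree_DPD.
(* The uniform bound [B] shows that the set defining [SWR] is nonempty, so [least] is attained. *)
have [H _] := @leastP [set s | forall g : {mpoly K[r]}, (DPD g <= m)%N ->
    (WR g <= s)%N] (ex_intro _ B (fun g gm => (WRP (circ g gm)).2 B (circ g gm))).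
exact: powering_circuit_widen (H f fm) (WRP (circ f fm)).1.
Qed.

(** * Unipotent matrices *)

(** The minimal polynomial divides [X^m], hence is associate to some [X^k]; it also divides the
    characteristic polynomial, of degree [w.+1]. *)
Lemma nilmx_exp (K : fieldType) (w m : nat) (N : 'M[K]_w.+1) :
  N ^+ m = 0 -> N ^+ w.+1 = 0.
Proof.
move=> Nm; have : mxminpoly N %| ('X - 0%:P) ^+ m.
  by apply: mxminpoly_min; rewrite subr0 rmorphXn /= horner_mx_X.
case/dvdp_exp_XsubCP => k km; rewrite subr0 => eqk.
have kw : (k <= w.+1)%N.
  rewrite -ltnS -(size_polyXn K k) -(eqp_size eqk) -(size_char_poly N).
  apply: dvdp_leq (mxminpoly_dvd_char N).
  by rewrite -size_poly_gt0 size_char_poly.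
have : mxminpoly N %| 'X^k by rewrite (eqp_dvdl _ eqk).
move/mxminpoly_minP; rewrite rmorphXn /= horner_mx_X => Nk.
have -> : N ^+ w.+1 = N ^+ (w.+1 - k) * N ^+ k by rewrite -exprD subnK.
by rewrite Nk mulr0.
Qed.

Lemma nil_sum_comm (K : fieldType) (A : algType K) (I : finType) (y : I -> A) :
  (forall i j, GRing.comm (y i) (y j)) -> (forall i, exists m, y i ^+ m = 0) ->
  forall c : I -> K, exists m, (\sum_i c i *: y i) ^+ m = 0.
Proof.
move=> cy ny c; elim: (index_enum I) => [|i r [m Hm]].
  by exists 1%N; rewrite big_nil expr1.
have [k Hk] := ny i; exists (k + m)%N; rewrite big_cons.
set z := \sum_(j <- r) _ in Hm *.
have cz : GRing.comm (c i *: y i) z.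
  apply: commr_sum => j _; rewrite /GRing.comm -!scalerAl -!scalerAr cy.
  by rewrite !scalerA mulrC.
rewrite exprDn_comm // big1 // => j _.
have [jm|jm] := leqP m j.
  by rewrite -(subnK jm) (exprD z) Hm !mulr0 mul0rn.
have kj : (k <= k + m - j)%N by rewrite -addnBA ?leq_addr // ltnW.
by rewrite -(subnK kj) exprD (exprZn _ _ k) Hk scaler0 mulr0 mul0r mul0rn.
Qed.

(** Flattened matrices live in dimension [w * w], which is the source of the number of variables in
    [SWR]. The [B k] are themselves combinations of the [y i], so they inherit commutation and
    nilpotency. *)
Lemma spanning_family (K : fieldType) (w : nat) (I : finType) (y : I -> 'M[K]_w) :
  exists (B : 'I_(w * w) -> 'M[K]_w) (c : I -> 'I_(w * w) -> K)
      (b : 'I_(w * w) -> I -> K),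
    (forall i, y i = \sum_k c i k *: B k) /\
    (forall k, B k = \sum_i b k i *: y i).
Proof.
pose Y : 'M[K]_(#|I|, w * w) := \matrix_r mxvec (y (enum_val r)).
(* [G] is a square matrix with the row space of [Y], so it has exactly [w * w] rows whatever the
   rank. *)
pose G : 'M[K]_(w * w) := <<Y>>%MS.
have /submxP[C EC] : (Y <= G)%MS by rewrite genmxE.
have /submxP[D ED] : (G <= Y)%MS by rewrite genmxE.
exists (fun k => vec_mx (row k G)), (fun i k => C (enum_rank i) k).
exists (fun k i => D k (enum_rank i)); split=> [i|k].
  apply: (can_inj mxvecK); rewrite raddf_sum /=.
  under eq_bigr do rewrite linearZ /= vec_mxK.
  have -> : mxvec (y i) = row (enum_rank i) Y by rewrite rowK enum_rankK.
  by rewrite EC row_mul mulmx_sum_row; apply: eq_bigr => k _; rewrite mxE.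
apply: (can_inj mxvecK); rewrite raddf_sum /= vec_mxK {1}ED row_mul mulmx_sum_row.
rewrite (reindex (fun i : I => enum_rank i)) /=; last first.
  by apply: onW_bij; apply: enum_rank_bij.
apply: eq_bigr => i _; rewrite mxE rowK enum_rankK.
by rewrite linearZ.
Qed.

Lemma poly_eq_values (K : numFieldType) (p q : {poly K}) :
  (forall z, p.[z] = q.[z]) -> p = q.
Proof.
move=> E; apply/eqP; rewrite -subr_eq0; apply/negPn/negP => nz.
pose s := [seq (i%:R : K) | i <- iota 0 (size (p - q)%R)].
have : (size s < size (p - q)%R)%N.
  apply: max_poly_roots => //.
    by apply/allP => z _; rewrite /root !hornerE E subrr.
  rewrite map_inj_uniq ?iota_uniq // => i j /eqP.
  by rewrite eqr_nat => /eqP.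
by rewrite size_map size_iota ltnn.
Qed.

Lemma coef_affine_exp (K : comNzRingType) (a b : K) (m e : nat) :
  ((a%:P + b *: 'X) ^+ m)`_e = 'C(m, e)%:R * a ^+ (m - e) * b ^+ e.
Proof.
rewrite exprDn coef_sum.
under eq_bigr => i _ do
  rewrite coefMn exprZn -scalerAr coefZ -rmorphXn coefCM coefXn.
have [em|me] := ltnP e m.+1; last first.
  rewrite bin_small // !mul0r big1 // => i _; rewrite gtn_eqF ?mulr0 ?mul0r ?mul0rn //.
  exact: leq_trans (ltn_ord i) me.
rewrite (bigD1 (Ordinal em)) //= eqxx big1 => [|i ie].
  by rewrite addr0 mulr1 (mulrC (b ^+ e)) -mulrA mulr_natl.
rewrite (_ : (e == i) = false) ?mulr0 ?mul0r ?mul0rn //.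
by apply: contra_neqF ie => /eqP ei; apply: val_inj.
Qed.

(** * The exponential polynomial of commuting nilpotent matrices *)

Section ExpPolynomial.
Variables (K : numFieldType) (w r : nat).
Variables (u v : 'cV[K]_w.+1) (B : 'I_r -> 'M[K]_w.+1).
Hypothesis B_comm : forall k l, GRing.comm (B k) (B l).
Hypothesis B_nil : forall c : 'I_r -> K, (\sum_k c k *: B k) ^+ w.+1 = 0.

Let powB (m : 'I_r -> nat) := \prod_k B k ^+ m k.

Lemma B_exp0 k : B k ^+ w.+1 = 0.
Proof.
rewrite -[RHS](B_nil (fun l => (l == k)%:R)) (bigD1 k) //= eqxx scale1r.
by rewrite big1 ?addr0 // => l /negPf ->; rewrite scale0r.
Qed.

Lemma powB0 m k : (w < m k)%N -> powB m = 0.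
Proof.
move=> wm; rewrite /powB; have : k \in index_enum 'I_r by rewrite mem_index_enum.
elim: (index_enum _) => // i s IHs; rewrite inE big_cons => /orP[/eqP <-|/IHs ->].
  by rewrite -(subnK wm) exprD B_exp0 mulr0 mul0r.
by rewrite mulr0.
Qed.

(* With [M = 1], the polynomial [u^T exp (sum_k t_k B_k) v]; its derivative of
   order [e] is given by [M = powB e]. *)
Definition exp_mpoly (M : 'M[K]_w.+1) : {mpoly K[r]} :=
  \sum_(e : {ffun 'I_r -> 'I_w.+1})
    (\prod_k ((e k)`!)%:R^-1 * bilin u v (M * powB (fun k => e k)))
      *: 'X_[[multinom (e k : nat) | k < r]].

(** The formula extends beyond the box of summation because [powB m] vanishes once an exponent
    exceeds [w]. *)
Lemma mcoeff_exp_mpoly M (m : 'X_{1..r}) :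
  (exp_mpoly M)@_m = \prod_k ((m k)`!)%:R^-1 * bilin u v (M * powB m).
Proof.
rewrite /exp_mpoly raddf_sum /=; under eq_bigr do rewrite mcoeffZ mcoeffX.
have [/forallP mw|/forallPn[k]] := boolP [forall k, (m k < w.+1)%N]; last first.
  rewrite -leqNgt => wm; rewrite (@powB0 _ k wm) mulr0 /bilin mulmx0 mul0mx mxE mulr0.
  apply: big1 => e _; rewrite (_ : (_ == _) = false) ?mulr0 //.
  by apply/eqP => E; move: wm; rewrite -E mnmE leqNgt ltn_ord.
pose e := [ffun k => Ordinal (mw k)].
have Ee : [multinom (e k : nat) | k < r]%MM = m by apply/mnmP => k; rewrite mnmE ffunE.
rewrite (bigD1 e) //= Ee eqxx mulr1 [X in _ + X]big1 ?addr0 => [|e' ne].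
  have em k : e k = m k :> nat by rewrite ffunE.
  have -> : \prod_k ((e k)`!)%:R^-1 = \prod_k ((m k)`!)%:R^-1 :> K.
    by apply: eq_bigr => k _; rewrite em.
  rewrite (_ : powB _ = powB m) //.
  by apply: eq_bigr => k _; rewrite em.
case: eqP => [E|]; last by rewrite mulr0.
case/eqP: ne; apply/ffunP => k; apply: val_inj.
by rewrite ffunE /= -E mnmE.
Qed.

(** The falling factorials produced by differentiation turn each [1/(e+m)!] into [1/m!], while
    [powB (e + m)] factors by commutation. *)
Lemma mderiv_exp_mpoly (e : 'X_{1..r}) : (exp_mpoly 1)^`M[e] = exp_mpoly (powB e).
Proof.
apply/mpolyP => m; rewrite mcoeff_mderivm !mcoeff_exp_mpoly mul1r.
have -> : powB (e + m)%MM = powB e * powB m.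
  rewrite -prodrM_comm => [|i j _ _].
    by apply: eq_bigr => k _; rewrite mnmDE exprD.
  by apply: commrX; apply/commr_sym; apply: commrX; apply: B_comm.
rewrite -mulr_natl mulrA natr_prod -big_split /=; congr (_ * _).
apply: eq_bigr => k _; rewrite mnmDE.
rewrite -(ffact_fact (leq_addr (m k) (e k))) addKn natrM invfM mulrA mulfV ?mul1r //.
by rewrite pnatr_eq0 -lt0n ffact_gt0 leq_addr.
Qed.

(** All derivatives lie in the image of the matrix space under the linear map [exp_mpoly]; its
    dimension is the second argument of [SWR]. *)
Lemma DPD_exp_mpoly : (DPD (exp_mpoly 1) <= w.+1 ^ 2)%N.
Proof.
apply: (dim_le (g := fun k : 'I_(w.+1 * w.+1) =>
  exp_mpoly (vec_mx (delta_mx 0 k)))).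
apply: spanned_linspan => _ [e _ <-]; rewrite mderiv_exp_mpoly.
move: (powB e) => M; exists (mxvec M 0).
apply/mpolyP => m; rewrite mcoeff_exp_mpoly raddf_sum /=.
have EM : M = \sum_k mxvec M 0 k *: vec_mx (delta_mx 0 k).
  rewrite -{1}(mxvecK M) {1}(row_sum_delta (mxvec M)) raddf_sum /=.
  by apply: eq_bigr => k _; rewrite linearZ.
rewrite {1}EM mulr_suml bilin_sum mulr_sumr; apply: eq_bigr => k _.
by rewrite -scalerAl bilinZ mcoeffZ mcoeff_exp_mpoly mulrCA.
Qed.

Lemma meval_exp_mpoly (t : 'I_r -> K) :
  (exp_mpoly 1).@[t] = bilin u v (truncexp w.+1 (\sum_k t k *: B k)).
Proof.
rewrite truncexp_sum //; last first.
- by move=> c; under eq_bigr do rewrite scalerA; apply: B_nil.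
- move=> k l; rewrite /GRing.comm -!scalerAl -!scalerAr B_comm.
  by rewrite !scalerA mulrC.
rewrite /truncexp bigA_distr_bigA bilin_sum raddf_sum /=.
apply: eq_bigr => e _; rewrite mevalZ mevalX mul1r.
under [in RHS]eq_bigr do rewrite exprZn scalerA.
rewrite prod_scalemx bilinZ mulrAC -big_split; congr (_ * _).
by apply: eq_bigr => k _; rewrite mnmE.
Qed.

(* Comparing the coefficients of [z^e] in both expressions of [F(z t)]
   discards the part of degree [> w] of each power. *)
Lemma exp_mpoly_powers :
  exists (P : 'I_(SWR K r (w.+1 ^ 2)) -> {poly K})
      (a : 'I_(SWR K r (w.+1 ^ 2)) -> 'I_r -> K),
    (forall s, (size (P s) <= w.+1)%N) /\
    forall t : 'I_r -> K, bilin u v (truncexp w.+1 (\sum_k t k *: B k)) =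
      \sum_s (P s).[\sum_k a s k * t k].
Proof.
have [be [a0 [a [e EF]]]] := powering_circuit_SWR DPD_exp_mpoly.
(* [P s] is [be s * (a0 s + X) ^ e s] truncated to degree at most [w]. *)
exists (fun s => \poly_(i < w.+1) (be s * ('C(e s, i)%:R * a0 s ^+ (e s - i)))), a.
split=> [s|t]; first exact: size_poly.
pose Y := \sum_k t k *: B k; pose ell s := \sum_k a s k * t k.
pose p : {poly K} := \poly_(i < w.+1) ((i`!)%:R^-1 * bilin u v (Y ^+ i)).
pose q : {poly K} := \sum_s be s *: ((a0 s)%:P + ell s *: 'X) ^+ e s.
have pz z : p.[z] = bilin u v (truncexp w.+1 (z *: Y)).
  rewrite horner_poly bilin_sum; apply: eq_bigr => i _.
  by rewrite exprZn !bilinZ mulrAC mulrA.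
have pq : p = q.
  apply: poly_eq_values => z.
  have -> : p.[z] = (exp_mpoly 1).@[fun k => z * t k].
    rewrite pz meval_exp_mpoly /Y scaler_sumr.
    by under eq_bigr do rewrite scalerA.
  rewrite EF raddf_sum /= horner_sum; apply: eq_bigr => s _.
  rewrite mevalZ rmorphXn rmorphD /= mevalC hornerZ horner_exp.
  rewrite !hornerE raddf_sum mulr_suml; congr (_ * (_ + _) ^+ _).
  apply: eq_bigr => k _.
  by rewrite /= mevalZ mevalXU mulrAC mulrA.
have -> : bilin u v (truncexp w.+1 Y) = p.[1] by rewrite pz scale1r.
rewrite (@horner_coef_wide _ w.+1 p 1) ?size_poly // pq.
under [RHS]eq_bigr do rewrite horner_poly.
rewrite exchange_big; apply: eq_bigr => i _.
rewrite expr1n mulr1 coef_sum; apply: eq_bigr => s _.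
by rewrite coefZ coef_affine_exp !mulrA.
Qed.

End ExpPolynomial.

Lemma cprank_unipotent (K : numFieldType) (n w : nat) (J : finType)
    (N : 'I_n -> J -> 'M[K]_w.+1) (u v : 'cV[K]_w.+1) :
  (0 < n)%N -> (forall i j k l, GRing.comm (N i j) (N k l)) ->
  (forall i j, exists m, N i j ^+ m = 0) ->
  cprank_le (SWR K (w.+1 ^ 2) (w.+1 ^ 2) * (n * w.+1))
    (fun j => bilin u v (\prod_i (1 + N i (j i)))).
Proof.
move=> n0 cN nN; have [q Hq] := nilmx_log K w w.+1.
(* [y x] is the logarithm of [1 + N x.1 x.2]. *)
pose y (x : 'I_n * J) := N x.1 x.2 * horner_mx (N x.1 x.2) q.
have cy x x' : GRing.comm (y x) (y x').
  have H i j k l p : GRing.comm (N i j) (horner_mx (N k l) p).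
    by apply: comm_mx_horner; apply: cN.
  apply: commrM; apply/commr_sym; apply: commrM; rewrite ?cN //;
    try exact: H; try exact/commr_sym/H.
  by apply: comm_mx_horner; apply/commr_sym/H.
have ny x : exists m, y x ^+ m = 0.
  have [m Nm] := nN x.1 x.2; exists m; rewrite exprMn_comm ?Nm ?mul0r //.
  exact: comm_mx_horner.
have [B [c [b [Ey EB]]]] := spanning_family y.
have cB k l : GRing.comm (B k) (B l).
  rewrite !EB; apply: commr_sum => x _; apply/commr_sym; apply: commr_sum => x' _.
  by rewrite /GRing.comm -!scalerAl -!scalerAr cy !scalerA mulrC.
have nc (d : 'I_n * J -> K) : (\sum_x d x *: y x) ^+ w.+1 = 0.
  by have [m /nilmx_exp] := nil_sum_comm cy ny d.
have nB (d : 'I_(w.+1 * w.+1) -> K) : (\sum_k d k *: B k) ^+ w.+1 = 0.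
  rewrite -[RHS](nc (fun x => \sum_k d k * b k x)); congr (_ ^+ _).
  under eq_bigr => k _ do rewrite EB scaler_sumr.
  rewrite exchange_big; apply: eq_bigr => x _ /=.
  by rewrite scaler_suml; apply: eq_bigr => k _; rewrite scalerA.
have [P [a [sP EP]]] := exp_mpoly_powers u v cB nB.
have /choice [cf Hcf] := fun s => horner_sum_products n0 (ltn0Sn w) (sP s).
have /choice [h Hh] := Hcf.
rewrite -[X in (_ * X)%N]card_ord -[X in (X * _)%N]card_ord -card_prod.
(* The argument of the linear form [a s] is a sum over [i] of terms depending only on [i] and [j i],
   so each [h s l] factor sees a single mode. *)
apply: (cprank_fin (c := fun sl => cf sl.1 sl.2) (h := fun sl i j =>
  h sl.1 sl.2 (\sum_k a sl.1 k * c (i, j) k))) => j.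
rewrite -(pair_bigA _ (fun s l => cf s l * \prod_i h s l (\sum_k a s k * c (i, j i) k))).
transitivity (bilin u v (truncexp w.+1 (\sum_i y (i, j i)))).
  rewrite truncexp_sum //.
    by congr (bilin u v _); apply: eq_bigr => i _; rewrite Hq //;
       have [m /nilmx_exp] := nN i (j i).
  (* A combination of the [y (i, j i)] is extended by zero coefficients to all pairs, where
     nilpotency is known. *)
  move=> d; rewrite -[RHS](nc (fun x => (x.2 == j x.1)%:R * d x.1)).
  congr (_ ^+ _); rewrite -(pair_bigA _ (fun i l => ((l == j i)%:R * d i) *: y (i, l))).
  apply: eq_bigr => i _ /=; rewrite (bigD1 (j i)) //= eqxx mul1r big1 ?addr0 //.
  by move=> l /negPf ->; rewrite mul0r scale0r.
have -> : \sum_i y (i, j i) = \sum_k (\sum_i c (i, j i) k) *: B k.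
  under eq_bigr do rewrite Ey; rewrite exchange_big /=.
  by apply: eq_bigr => k _; rewrite scaler_suml.
rewrite EP; apply: eq_bigr => s _; rewrite -Hh; congr (_.[_]).
by rewrite exchange_big; apply: eq_bigr => k _; rewrite mulr_sumr.
Qed.

(** * Commuting matrices *)

(** Multiplying [X] by the factors [A - z] one at a time, the product must vanish at some first
    factor; the last nonzero product is the one sought. *)
Lemma annihilated_root (K : fieldType) (w : nat) (A X : 'M[K]_w.+1) (r : seq K) :
  X != 0 -> X * horner_mx A (\prod_(z <- r) ('X - z%:P)) = 0 ->
  exists2 z, z \in r & exists2 p, X * horner_mx A p != 0 &
    X * horner_mx A p * horner_mx A ('X - z%:P) = 0.
Proof.
elim: r X => [|z r IHr] X X0.
  by rewrite big_nil rmorph1 mulr1 => /eqP; rewrite (negPf X0).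
rewrite big_cons rmorphM /= mulrA => Xr.
have [Xz|Xz] := eqVneq (X * horner_mx A ('X - z%:P)) 0.
  exists z; first exact: mem_head.
  by exists 1; rewrite rmorph1 mulr1.
have [z' z'r [p Xp Xpz]] := IHr _ Xz Xr.
exists z'; first by rewrite inE z'r orbT.
by exists (('X - z%:P) * p); rewrite rmorphM /= mulrA.
Qed.

(* [E1] is the component of [E] on the generalized eigenspace of [A] for an
   eigenvalue of [A] on the image of [E]. *)
Lemma split_idempotent (K : closedFieldType) (w : nat) (A E : 'M[K]_w.+1) :
  E * E = E -> GRing.comm A E ->
  (exists l m, ((A - l%:M) * E) ^+ m = 0) \/
  exists p q, let E1 := E * horner_mx A p in let E2 := E * horner_mx A q in
    [/\ E1 != 0, E2 != 0, E = E1 + E2, E1 * E1 = E1 /\ E2 * E2 = E2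
      & E1 * E2 = 0 /\ E2 * E1 = 0].
Proof.
move=> EE cAE.
have [->|E0] := eqVneq E 0.
  by left; exists 0, 1%N; rewrite mulr0 expr1.
have cE p : GRing.comm (horner_mx A p) E.
  by apply/commr_sym/comm_mx_horner/commr_sym.
have [r] := closed_field_poly_normal (char_poly A).
rewrite (monicP (char_poly_monic A)) scale1r => Er.
have [z zr [p Xp Xpz]] : exists2 z, z \in r & exists2 p, E * horner_mx A p != 0 &
    E * horner_mx A p * horner_mx A ('X - z%:P) = 0.
  by apply: annihilated_root => //; rewrite -Er Cayley_Hamilton mulr0.
have [m [q]] := multiplicity_XsubC (char_poly A) z.
rewrite monic_neq0 ?char_poly_monic //= => qz Eq.
have m0 : (0 < m)%N.
  rewrite lt0n; apply: contraNneq qz => m0.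
  by rewrite m0 expr0 mulr1 in Eq; rewrite -Eq Er root_prod_XsubC.
have /Bezout_eq1_coprimepP[[a b] /= ab1] : coprimep q (('X - z%:P) ^+ m).
  by rewrite coprimep_expr // coprimep_XsubC.
(* By Bezout and Cayley-Hamilton, [e1] and [e2] give complementary orthogonal idempotents at [A];
   [e1], a multiple of [q], belongs to the eigenvalue [z]. *)
pose e1 := a * q; pose e2 := b * ('X - z%:P) ^+ m.
have h12 : horner_mx A e1 * horner_mx A e2 = 0.
  rewrite -rmorphM /= (_ : e1 * e2 = a * b * char_poly A); last first.
    by rewrite Eq /e1 /e2 mulrACA.
  by rewrite rmorphM /= Cayley_Hamilton mulr0.
have h21 : horner_mx A e2 * horner_mx A e1 = 0.
  by rewrite -rmorphM /= mulrC rmorphM.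
have hD : horner_mx A e1 + horner_mx A e2 = 1 by rewrite -rmorphD /= ab1 rmorph1.
have prodE x y : E * horner_mx A x * (E * horner_mx A y) =
    E * (horner_mx A x * horner_mx A y).
  by rewrite -mulrA (mulrA (horner_mx A x)) cE -(mulrA E (horner_mx A x)) (mulrA E E) EE.
(* [E p(A)] is killed by [A - z], hence by [e2(A)] as [m > 0], so [e1(A)] fixes it; this is why
   [E e1(A)] is nonzero. *)
have E1p : E * horner_mx A e1 * horner_mx A p = E * horner_mx A p.
  rewrite -[RHS]mulr1 -hD mulrDr [X in _ + X](_ : _ = 0) ?addr0; last first.
    rewrite (_ : e2 = ('X - z%:P) * (b * ('X - z%:P) ^+ m.-1)); last first.
      by rewrite /e2 -{1}(prednK m0) exprS mulrCA.
    by rewrite rmorphM mulrA Xpz mul0r.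
  by rewrite -!mulrA -!rmorphM /= mulrC.
have E1n0 : E * horner_mx A e1 != 0.
  by apply: contraNneq Xp => E10; rewrite -E1p E10 mul0r.
have ED : E = E * horner_mx A e1 + E * horner_mx A e2 by rewrite -mulrDr hD mulr1.
have [E20|E2n0] := eqVneq (E * horner_mx A e2) 0; last first.
  right; exists e1, e2; split=> //; rewrite !prodE ?h12 ?h21 ?mulr0 //; split.
    by congr (_ * _); rewrite -[RHS]mulr1 -hD mulrDr h12 addr0.
  by congr (_ * _); rewrite -[RHS]mulr1 -hD mulrDr h21 add0r.
(* Here [E = E e1(A)], and [(X - z)^m e1] is a multiple of the characteristic polynomial. *)
left; exists z, m; have -> : A - z%:M = horner_mx A ('X - z%:P).
  by rewrite rmorphB /= horner_mx_X horner_mx_C.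
rewrite exprMn_comm // -(prednK m0).
have -> k : E ^+ k.+1 = E by elim: k => [|k IHk]; rewrite ?expr1 // exprS IHk.
rewrite -rmorphXn /= cE ED E20 addr0 -mulrA -rmorphM /= prednK //.
rewrite /e1 -mulrA -Eq rmorphM /= Cayley_Hamilton.
by rewrite !mulr0.
Qed.

(** Both row spaces lie in that of [E1 + E2]. A row in both is fixed by [E2] and by [E1], hence zero
    since [E2 * E1 = 0]. *)
Lemma mxrank_idempotentD (K : fieldType) (w : nat) (E1 E2 : 'M[K]_w.+1) :
  E1 * E1 = E1 -> E2 * E2 = E2 -> E1 * E2 = 0 -> E2 * E1 = 0 ->
  (\rank E1 + \rank E2 <= \rank (E1 + E2)%R)%N.
Proof.
move=> E11 E22 E12 E21.
have fixE (F : 'M[K]_w.+1) m (X : 'M[K]_(m, w.+1)) :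
    F * F = F -> (X <= F)%MS -> X *m F = X.
  by move=> FF /submxP[D ->]; rewrite -mulmxA [F *m F]FF.
rewrite -mxrank_disjoint_sum.
  apply: mxrankS; rewrite addsmx_sub; apply/andP; split.
    by rewrite -[X in (X <= _)%MS](_ : E1 *m (E1 + E2) = E1) ?submxMl //
      mulmxDr [E1 *m E1]E11 [E1 *m E2]E12 addr0.
  by rewrite -[X in (X <= _)%MS](_ : E2 *m (E1 + E2) = E2) ?submxMl //
    mulmxDr [E2 *m E1]E21 [E2 *m E2]E22 add0r.
rewrite -(fixE E1 _ _ E11 (capmxSl E1 E2)) -{1}(fixE E2 _ _ E22 (capmxSr E1 E2)).
by rewrite -mulmxA [E2 *m E1]E21 mulmx0.
Qed.

(** Induction on the rank: a non-primary [E] splits into two nonzero idempotents whose ranks add up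
    to at most that of [E]. Being [E] times polynomials in one [A i], they commute with the whole
    family. *)
Lemma primary_decomposition (K : closedFieldType) (w : nat) (I : Type)
    (A : I -> 'M[K]_w.+1) (E : 'M[K]_w.+1) :
  (forall i j, GRing.comm (A i) (A j)) ->
  E * E = E -> (forall i, GRing.comm (A i) E) ->
  exists s : seq 'M[K]_w.+1,
    [/\ (size s <= \rank E)%N, E = \sum_(F <- s) F
      & forall F, F \in s -> [/\ F * F = F, forall i, GRing.comm (A i) F
          & forall i, exists l m, ((A i - l%:M) * F) ^+ m = 0]].
Proof.
move=> cA; have [k] := ubnP (\rank E); elim: k E => // k IHk E rE EE cE.
have [->|E0] := eqVneq E 0; first by exists [::]; rewrite big_nil mxrank0.
have [prim|] := pselect (forall i, exists l m, ((A i - l%:M) * E) ^+ m = 0).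
  exists [:: E]; rewrite big_seq1 /= lt0n mxrank_eq0; split=> // F.
  by rewrite inE => /eqP ->.
move/existsNP => [i nprim].
have [//|[p [q]]] := split_idempotent EE (cE i).
set E1 := E * _; set E2 := E * _ => /= -[E10 E20 ED [E11 E22] [E12 E21]].
have rD := mxrank_idempotentD E11 E22 E12 E21; rewrite -ED in rD.
have cEp j p' : GRing.comm (A j) (E * horner_mx (A i) p').
  by apply: commrM; first exact: cE; apply: comm_mx_horner; apply: cA.
have r1 : (0 < \rank E1)%N by rewrite lt0n mxrank_eq0.
have r2 : (0 < \rank E2)%N by rewrite lt0n mxrank_eq0.
have [|s1 [s1r s1E s1P]] := IHk E1 _ E11 (fun j => cEp j p).
  by rewrite -ltnS (leq_trans _ rE) // ltnS (leq_trans _ rD) // -addn1 leq_add2l.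
have [|s2 [s2r s2E s2P]] := IHk E2 _ E22 (fun j => cEp j q).
  by rewrite -ltnS (leq_trans _ rE) // ltnS (leq_trans _ rD) // -add1n leq_add2r.
exists (s1 ++ s2); rewrite size_cat big_cat /= -s1E -s2E; split=> //.
  exact: leq_trans (leq_add s1r s2r) rD.
by move=> F; rewrite mem_cat => /orP[/s1P|/s2P].
Qed.

Lemma cprank_sum (K : fieldType) (n : nat) (J : finType) (W : nat)
    (I : eqType) (s : seq I) (T : I -> ('I_n -> J) -> K) :
  (forall F, F \in s -> cprank_le W (T F)) ->
  cprank_le (size s * W) (fun j => \sum_(F <- s) T F j).
Proof.
elim: s => [|F s IHs] H.
  exists (fun=> 0), (fun _ _ _ => 0) => j.
  by rewrite big_nil big1 // => i _; rewrite mul0r.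
have := cprankD (H F (mem_head _ _))
  (IHs (fun G Gs => H G (mem_behead (s := F :: s) Gs))).
by apply: cprank_ext => j; rewrite big_cons.
Qed.

(* The multilinear expansion of [l + N = (1 + N) + (l - 1) 1] reduces to
   unipotent matrices, including when [l = 0]. *)
Lemma cprank_local (K : numFieldType) (n w : nat) (J : finType)
    (A : 'I_n -> J -> 'M[K]_w.+1) (F : 'M[K]_w.+1) (u v : 'cV[K]_w.+1) :
  (0 < n)%N -> (forall i j k l, GRing.comm (A i j) (A k l)) ->
  F * F = F -> (forall i j, GRing.comm (A i j) F) ->
  (forall i j, exists l m, ((A i j - l%:M) * F) ^+ m = 0) ->
  cprank_le (SWR K (w.+1 ^ 2) (w.+1 ^ 2) * (n * w.+1))
    (fun j => bilin u v (\prod_i A i (j i) * F)).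
Proof.
move=> n0 cA FF cF prim.
have /choice [la Hla] := fun x : 'I_n * J => prim x.1 x.2.
pose N i j := (A i j - (la (i, j))%:M) * F.
have clM (l : K) (M : 'M[K]_w.+1) : GRing.comm M l%:M.
  by rewrite /GRing.comm [LHS]scalar_mxC.
have cN i j k l : GRing.comm (N i j) (N k l).
  have cAN : GRing.comm (A i j) (N k l).
    by apply: commrM => //; apply: commrB.
  have cFN : GRing.comm F (N k l).
    by apply: commrM => //; apply: commrB => //; apply/commr_sym.
  apply/commr_sym/commrM; last exact/commr_sym.
  by apply: commrB; apply/commr_sym => //; apply/commr_sym.
(* The extra index [None] adds the identity, as [1 + 0], to the unipotent family; [gam] then writes
   [l + N] as [(1 + N) + (l - 1) 1]. *)
pose N' i (o : option J) := if o is Some j then N i j else 0.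
have cN' i j k l : GRing.comm (N' i j) (N' k l).
  case: j l => [j|] [l|] //=; first exact: commr0.
  exact/commr_sym/commr0.
have nN' i j : exists m, N' i j ^+ m = 0.
  case: j => [j|]; first exact: (Hla (i, j)).
  by exists 1%N.
pose gam i j (o : option J) : K := if o is Some j' then (j' == j)%:R else la (i, j) - 1.
have := cprank_contract (M := fun i k => 1 + N' i k) gam
  (cprank_unipotent u (F *m v) n0 cN' nN').
apply: cprank_ext => j.
have EN i : \sum_k gam i (j i) k *: (1 + N' i k) = (la (i, j i))%:M + N i (j i).
  rewrite (bigD1 None) //= (bigD1 (Some (j i))) //= eqxx scale1r big1 => [|[k|] //].
    by rewrite !addr0 addrA scalerBl scale1r subrK scalemx1.
  by case/andP => _ kj; rewrite /= (negPf (kj : k != j i)) scale0r.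
under eq_bigr do rewrite EN.
(* [A F = (l + N) F] because [F] is idempotent, and [F] commutes past every factor; the final [F] is
   carried by the vector [F *m v]. *)
suff -> : \prod_i A i (j i) * F = \prod_i ((la (i, j i))%:M + N i (j i)) * F.
  by rewrite /bilin !mulmxA.
elim: (index_enum _) => [|i r IHr]; first by rewrite !big_nil.
rewrite !big_cons -!mulrA IHr.
set X := \prod_(j <- r) _; have cFX : GRing.comm F X.
  apply: commr_prod => k _; apply: commrD => //; apply: commrM => //.
  by apply: commrB => //; apply/commr_sym.
rewrite -cFX !mulrA; congr (_ * _).
by rewrite mulrDl /N -mulrA FF mulrBl addrC subrK.
Qed.

Lemma cprank_commuting (K : numClosedFieldType) (n w : nat) (J : finType)
    (A : 'I_n -> J -> 'M[K]_w) (u v : 'cV[K]_w) :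
  (0 < n)%N -> (forall i j k l, comm_mx (A i j) (A k l)) ->
  cprank_le (SWR K (w ^ 2) (w ^ 2) * n * w ^ 4)
    (fun j => bilin u v (\prod_i A i (j i))).
Proof.
move=> n0; case: w A u v => [|w] A u v cA.
  (* For [w = 0] the bilinear form is an empty sum, so the tensor is zero. *)
  exists (fun=> 0), (fun _ _ _ => 0) => j; rewrite /bilin mxE big_ord0.
  by rewrite big1 // => s _; rewrite mul0r.
have [s [sr s1 sP]] := @primary_decomposition K w _ (fun x : 'I_n * J => A x.1 x.2) 1
  (fun x y => cA _ _ _ _) (mulr1 _) (fun x => commr1 _).
have := @cprank_sum K n J (SWR K (w.+1 ^ 2) (w.+1 ^ 2) * (n * w.+1)) _ s
  (fun F j => bilin u v (\prod_i A i (j i) * F)).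
move=> H; have {}H := H _.
(* At most [w] idempotents, each contributing [S * n * w] products, give [S * n * w^2], which is
   below the stated bound. *)
apply: (cprank_widen (W1 := size s * (SWR K (w.+1 ^ 2) (w.+1 ^ 2) * (n * w.+1)))).
  rewrite mulnCA -mulnA leq_mul2l mulnCA leq_mul2l.
  rewrite mxrank1 in sr; apply/orP; right; apply/orP; right.
  apply: leq_trans (leq_mul sr (leqnn _)) _.
  by rewrite -(expnD _ 1 1) leq_pexp2l.
apply: cprank_ext (H _) => [j|F /sP[FF cF prim]].
  by rewrite -bilin_sum -mulr_sumr -s1 mulr1.
apply: cprank_local => // [i j|i j]; first exact: (cF (i, j)).
exact: (prim (i, j)).
Qed.

Theorem theorem1p9 (R : realType) (n d w : nat) (n_gt0 : (0 < n)%N) :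
  commROABP R[i] n d w `<=`
  diagROABP R[i] n d (SWR R[i] (w ^ 2) (w ^ 2) * n * w ^ 4)%N.
Proof.
move=> f [fd [u [v [A [cA Ef]]]]]; split=> //.
have /cprank_diag[u' [v' [A' [dA' EA']]]] := cprank_commuting u v n_gt0 cA.
exists u', v', A'; split=> //; rewrite Ef !roabp_polyE.
by apply: eq_bigr => j _; rewrite EA'.
Qed.
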